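(* Let $f:\mathbb{R}^d\to\mathbb{R}$ be $L$-smooth, convex, with a minimizer $x^*$ and with bounded level set at $x^0$, i.e. $R_0:=\max\{\|x-x^*\|_{\mathcal D}^*\mid f(x)\le f(x^0)\}<+\infty$, and let the probability distribution $\mathcal{D}$ on $\mathbb{R}^d$ satisfy Assumption D (see context) with constants $\gamma_{\mathcal D}$, $\mu_{\mathcal D}$ and norm $\|\cdot\|_{\mathcal D}$. If $\gamma^k\equiv\gamma<\frac{(1-\beta)R_0}{\mu_{\mathcal D}}$, then the iterates of SMTP satisfy $$\mathbf{E}\left[f(z^k)-f(x^* )\right]\le\left(1-\frac{\gamma\mu_{\mathcal D}}{(1-\beta)R_0}\right)^k(f(x^0)-f(x^* ))+\frac{L\gamma\gamma_{\mathcal D}R_0}{2(1-\beta)\mu_{\mathcal D}}.$$ If we choose $\gamma=\frac{\varepsilon(1-\beta)\mu_{\mathcal D}}{L\gamma_{\mathcal D}R_0}$ for some $0<\varepsilon\le\frac{L\gamma_{\mathcal D}R_0^2}{\mu_{\mathcal D}^2}$ and run SMTP for $k=K$ iterations, where $$K=\frac1\varepsilon\frac{L\gamma_{\mathcal D}R_0^2}{\mu_{\mathcal D}^2}\ln\left(\frac{2(f(x^0)-f(x^* ))}{\varepsilon}\right),$$ then $\mathbf{E}[f(z^K)]-f(x^* )\le\varepsilon$.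
   Context: $f:\mathbb{R}^d\to\mathbb{R}$ is $L$-smooth if it is differentiable and $\|\nabla f(x)-\nabla f(y)\|_2\le L\|x-y\|_2$ for all $x,y\in\mathbb{R}^d$. Assumption D on the distribution $\mathcal D$: (1) $\gamma_{\mathcal D}:=\mathbf{E}_{s\sim\mathcal D}\|s\|_2^2$ is finite; (2) there is a constant $\mu_{\mathcal D}>0$ and a norm $\|\cdot\|_{\mathcal D}$ on $\mathbb{R}^d$ such that $\mathbf{E}_{s\sim\mathcal D}|\langle g,s\rangle|\ge\mu_{\mathcal D}\|g\|_{\mathcal D}$ for all $g\in\mathbb{R}^d$. The dual norm is $\|\xi\|_{\mathcal D}^*:=\max\{\langle\xi,x\rangle\mid\|x\|_{\mathcal D}\le1\}$. Algorithm SMTP (Stochastic Momentum Three Points). Input: positive stepsizes (learning rates) $\{\gamma^k\}_{k\ge0}$, starting point $x^0\in\mathbb{R}^d$, distribution $\mathcal D$ on $\mathbb{R}^d$, momentum parameter $0\le\beta<1$. Set $v^{-1}=0$, $z^0=x^0$. For $k=0,1,\ldots$: sample $s^k\sim\mathcal D$ (independently of the past); let $v_\pm^k=\beta v^{k-1}\pm s^k$; $x_\pm^{k+1}=x^k-\gamma^kv_\pm^k$; $z_\pm^{k+1}=x_\pm^{k+1}-\frac{\gamma^k\beta}{1-\beta}v_\pm^k$; let $z^{k+1}$ be a point among $z^k,z_+^{k+1},z_-^{k+1}$ with the smallest value of $f$; and set $(x^{k+1},v^k)=(x_+^{k+1},v_+^k)$ if $z^{k+1}=z_+^{k+1}$,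 $(x^{k+1},v^k)=(x_-^{k+1},v_-^k)$ if $z^{k+1}=z_-^{k+1}$, and $(x^{k+1},v^k)=(x^k,v^{k-1})$ if $z^{k+1}=z^k$. $\mathbf{E}$ denotes expectation with respect to all randomness. The number of iterations $K$ is understood as rounded up to a nonnegative integer. *)

(* Defs.v *)
From HB Require Import structures.
From mathcomp Require Import all_boot all_order all_algebra.
From mathcomp Require Import all_classical all_reals all_analysis.

Set Implicit Arguments.
Unset Strict Implicit.
Unset Printing Implicit Defensive.

Import Order.TTheory GRing.Theory Num.Theory.
Import numFieldNormedType.Exports.

Local Open Scope classical_set_scope.
Local Open Scope ring_scope.

(* The canonical norm of 'rV[R]_d in the library is the sup norm, so the
   Euclidean inner product and norm are introduced here. Differentiability and
   open sets do not depend on the choice of norm. *)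
Definition dot {R : realType} {d : nat} (u v : 'rV[R]_d) : R :=
  \sum_i u 0 i * v 0 i.

Definition norm2 {R : realType} {d : nat} (u : 'rV[R]_d) : R :=
  Num.sqrt (dot u u).

Record is_norm {R : realType} {d : nat} (N : 'rV[R]_d -> R) : Prop := IsNorm {
  is_norm_ge0 : forall u, 0 <= N u;
  is_norm_eq0 : forall u, N u = 0 -> u = 0;
  is_normZ : forall (a : R) u, N (a *: u) = `|a| * N u;
  is_normD : forall u v, N (u + v) <= N u + N v
}.

(* The supremum is a maximum: the unit ball of N is compact. *)
Definition dual_norm {R : realType} {d : nat} (N : 'rV[R]_d -> R)
    (xi : 'rV[R]_d) : R :=
  sup [set dot xi u | u in [set u | N u <= 1]].

Definition gradient {R : realType} {d : nat} (f : 'rV[R]_d -> R)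
    (u : 'rV[R]_d) : 'rV[R]_d :=
  \row_i 'd f u (delta_mx 0 i).

Definition smooth {R : realType} {d : nat} (L : R) (f : 'rV[R]_d -> R) : Prop :=
  (forall u, differentiable f u) /\
  (forall u v, norm2 (gradient f u - gradient f v) <= L * norm2 (u - v)).

(* 'rV[R]_d with its Borel sigma-algebra. *)
Notation borel_rV R d := (g_sigma_algebraType (@open 'rV[R]_d)).

Definition second_moment {R : realType} {d : nat}
    (D : probability (borel_rV R d) R) : \bar R :=
  'E_D[fun s : 'rV[R]_d => norm2 s ^+ 2].

Definition assumption_D {R : realType} {d : nat}
    (D : probability (borel_rV R d) R) (mu : R) (N : 'rV[R]_d -> R) : Prop :=
  [/\ (second_moment D < +oo)%E,
      0 < mu,
      is_norm N &
      forall g : 'rV[R]_d,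
        ((mu * N g)%:E <= 'E_D[fun s : 'rV[R]_d => `|dot g s|%R])%E].

Definition level_dists {R : realType} {d : nat} (f : 'rV[R]_d -> R)
    (N : 'rV[R]_d -> R) (x0 xs : 'rV[R]_d) : set R :=
  [set dual_norm N (x - xs) | x in [set x | f x <= f x0]].

Definition independent_of {d1 d2 : measure_display} {T : measurableType d1}
    {T' : measurableType d2} {R : realType} (P : probability T R)
    (G : set (set T)) (X : {RV P >-> T'}) : Prop :=
  forall (A : set T) (B : set T'), G A -> measurable B ->
    P (A `&` X @^-1` B) = (P A * P (X @^-1` B))%E.

(* One iteration, from (x, v, z) = (x^k, v^(k-1), z^k) to
   (x', v', z') = (x^(k+1), v^k, z^(k+1)). Ties in the minimization of f are
   broken arbitrarily. *)
Definition smtp_step {R : realType} {d : nat} (f : 'rV[R]_d -> R)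
    (gamma beta : R) (s x v z x' v' z' : 'rV[R]_d) : Prop :=
  let vp := beta *: v + s in
  let vm := beta *: v - s in
  let xp := x - gamma *: vp in
  let xm := x - gamma *: vm in
  let zp := xp - (gamma * beta / (1 - beta)) *: vp in
  let zm := xm - (gamma * beta / (1 - beta)) *: vm in
  [/\ f z' <= f z, f z' <= f zp & f z' <= f zm] /\
  [\/ [/\ z' = zp, x' = xp & v' = vp],
      [/\ z' = zm, x' = xm & v' = vm] |
      [/\ z' = z, x' = x & v' = v]].

Section smtp.
Context {dT : measure_display} {T : measurableType dT} {R : realType} {d : nat}.
Variable P : probability T R.
Implicit Types s x v z : nat -> {RV P >-> borel_rV R d}.

(* The sigma-algebra generated by everything known before s^k is sampled. The
   iterates are listed explicitly because, with arbitrary tie-breaking, they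
   need not be functions of the samples. *)
Definition history s x v z (k : nat) : set (set T) :=
  <<s \bigcup_(j in [set j | (j <= k)%N])
        (g_sigma_algebra_preimage (x j) `|` g_sigma_algebra_preimage (v j) `|`
         g_sigma_algebra_preimage (z j)) `|`
      \bigcup_(j in [set j | (j < k)%N]) g_sigma_algebra_preimage (s j) >>.

(* Index shift: v k is the momentum v^(k-1), so that v 0 is v^(-1) = 0. *)
Record SMTP (f : 'rV[R]_d -> R) (D : probability (borel_rV R d) R)
    (gamma : nat -> R) (beta : R) (x0 : 'rV[R]_d) s x v z : Prop := MkSMTP {
  smtp_init : forall w, [/\ x 0%N w = x0, v 0%N w = 0 :> 'rV[R]_d & z 0%N w = x0];
  smtp_law : forall k (B : set (borel_rV R d)), measurable B ->
    distribution P (s k) B = D B;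
  smtp_indep : forall k, independent_of (history s x v z k) (s k);
  smtp_iter : forall k w,
    smtp_step f (gamma k) beta (s k w) (x k w) (v k w) (z k w)
      (x k.+1 w) (v k.+1 w) (z k.+1 w)
}.

End smtp.

(* Rounding up to a natural number; negative reals are sent to 0. *)
Definition nat_ceil {R : realType} (a : R) : nat :=
  absz (Num.ceil (Num.max 0 a)).

(* Main.v *)
From HB Require Import structures.
Require Import Defs.
From mathcomp Require Import all_boot all_order all_algebra.
From mathcomp Require Import all_classical all_reals all_analysis.
From mathcomp Require Import measurable_realfun ring lra.

(** Since the momentum is discounted by beta, the point
    z = x - (gamma * beta / (1 - beta)) v attached to a state (x, v) moves by
    exactly -delta s or +delta s, with delta = gamma / (1 - beta), whenever the
    state moves (smtp_virtual_iterate, virtual_step). Seen through z, the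
    momentum disappears and the method is a plain random three-point search:
    f (z') is at most the smallest of f (z), f (z - delta s), f (z + delta s).

    For an L-smooth f the better of the two signs turns the linear term of the
    descent inequality into -delta |<grad f (z), s>| (smooth_descent,
    smtp_descent). The sample s is independent of z, so the joint law of (z, s)
    is a product; integrating in s first, with z fixed, the assumption on the
    distribution gives at least mu N (grad f (z)) (integral_independent_pair_ge,
    expected_slope_ge). Convexity together with the generalized Cauchy-Schwarz
    inequality for N and its dual norm bounds the optimality gap by
    R0 N (grad f (z)) on the initial level set, which the iterates never leave
    (gap_le_gradient). Writing a_k for the expected gap, this is the affine
    recursion a_(k+1) <= (1 - q) a_k + c with q = delta mu / R0 and
    c = L delta^2 gammaD / 2, whose fixed point c / q is the additive error of
    the bound (expected_gap_recursion, affine_recursion_le).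

    For the complexity bound, the prescribed stepsize makes c / q equal to
    eps / 2, and 1 / q equal to the factor of the logarithm in the number of
    iterations, so (1 - q)^K <= exp (- q K) brings the other term below eps / 2
    (nat_ceil_decay_le). *)

Set Implicit Arguments.
Unset Strict Implicit.
Unset Printing Implicit Defensive.

Import Order.TTheory GRing.Theory Num.Theory.
Import numFieldNormedType.Exports.

Local Open Scope classical_set_scope.
Local Open Scope ring_scope.

(** * Euclidean inner product and norm *)

Section euclidean.
Context {R : realType} {d : nat}.
Implicit Types u v w : 'rV[R]_d.

Lemma dotC u v : dot u v = dot v u.
Proof. by apply: eq_bigr => i _; rewrite mulrC. Qed.

Lemma dotDl u v w : dot (u + v) w = dot u w + dot v w.
Proof. by rewrite -big_split; apply: eq_bigr => i _; rewrite !mxE mulrDl. Qed.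

Lemma dotZl (a : R) u v : dot (a *: u) v = a * dot u v.
Proof. by rewrite mulr_sumr; apply: eq_bigr => i _; rewrite !mxE mulrA. Qed.

Lemma dotNl u v : dot (- u) v = - dot u v.
Proof. by rewrite -scaleN1r dotZl mulN1r. Qed.

Lemma dotBl u v w : dot (u - v) w = dot u w - dot v w.
Proof. by rewrite dotDl dotNl. Qed.

Lemma dotZr (a : R) u v : dot u (a *: v) = a * dot u v.
Proof. by rewrite dotC dotZl dotC. Qed.

Lemma dotNr u v : dot u (- v) = - dot u v.
Proof. by rewrite dotC dotNl dotC. Qed.

Lemma dotBr u v w : dot u (v - w) = dot u v - dot u w.
Proof. by rewrite dotC dotBl ![dot _ u]dotC. Qed.

Lemma dot0l u : dot 0 u = 0.
Proof. by rewrite -(scale0r u) dotZl mul0r. Qed.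

Lemma dot0r u : dot u 0 = 0.
Proof. by rewrite dotC dot0l. Qed.

Lemma dot_ge0 u : 0 <= dot u u.
Proof. by apply: sumr_ge0 => i _; rewrite -expr2 sqr_ge0. Qed.

Lemma dot_eq0 u : dot u u = 0 -> u = 0.
Proof.
move=> /eqP; rewrite psumr_eq0; last by move=> i _; rewrite -expr2 sqr_ge0.
move=> /allP u0; apply/rowP => i; rewrite mxE; apply/eqP.
by have := u0 i (mem_index_enum _); rewrite /= mulf_eq0 orbb.
Qed.

Lemma norm2_ge0 u : 0 <= norm2 u.
Proof. exact: sqrtr_ge0. Qed.

Lemma norm2_sqr u : norm2 u ^+ 2 = dot u u.
Proof. by rewrite sqr_sqrtr ?dot_ge0. Qed.

Lemma norm2_eq0 u : norm2 u = 0 -> u = 0.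
Proof. by move=> u0; apply: dot_eq0; rewrite -norm2_sqr u0 expr0n. Qed.

Lemma norm2Z (a : R) u : norm2 (a *: u) = `|a| * norm2 u.
Proof.
by rewrite /norm2 dotZl dotZr mulrA -expr2 sqrtrM ?sqr_ge0// sqrtr_sqr.
Qed.

(** Positivity of the squared norm of norm2 v *: u - norm2 u *: v. *)
Lemma cauchy_schwarz u v : dot u v <= norm2 u * norm2 v.
Proof.
have [u0|u0] := eqVneq (norm2 u) 0.
  by rewrite (norm2_eq0 u0) dot0l mulr_ge0 ?norm2_ge0.
have [v0|v0] := eqVneq (norm2 v) 0.
  by rewrite (norm2_eq0 v0) dot0r mulr_ge0 ?norm2_ge0.
have p : 0 < norm2 u * norm2 v by rewrite mulr_gt0// lt_def ?u0 ?v0 norm2_ge0.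
have := dot_ge0 (norm2 v *: u - norm2 u *: v).
rewrite !(dotBl, dotBr, dotZl, dotZr) -!norm2_sqr (dotC v u) => h.
by rewrite -(ler_pM2l p); nra.
Qed.

Lemma coord_le_norm2 u i : `|u 0 i| <= norm2 u.
Proof.
rewrite -(sqrtr_sqr (u 0 i)) ler_sqrt ?dot_ge0// /dot (bigD1 i)//= -expr2 lerDl.
by apply: sumr_ge0 => j _; rewrite -expr2 sqr_ge0.
Qed.

Lemma rowB u v i : (u - v) 0 i = u 0 i - v 0 i.
Proof. by rewrite !mxE. Qed.

Lemma coord_le_mx_norm u i : `|u 0 i| <= `|u|.
Proof.
rewrite -[leRHS]/(mx_norm u) mx_normrE.
exact: (le_bigmax _ (fun k : 'I_1 * 'I_d => `|u k.1 k.2|) (0, i)).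
Qed.

Lemma dot_coord_le u v : dot u v <= (\sum_i `|u 0 i|) * `|v|.
Proof.
rewrite mulr_suml; apply: ler_sum => i _; apply: (le_trans (ler_norm _)).
by rewrite normrM ler_wpM2l// coord_le_mx_norm.
Qed.

Lemma coord_continuous_rV (i : 'I_d) :
  continuous (fun u : 'rV[R]_d => u 0 i).
Proof. exact: coord_continuous. Qed.

Lemma continuous_norm2 : continuous (fun u : 'rV[R]_d => norm2 u).
Proof.
move=> u; apply: (@continuous_comp _ _ _ (fun v => dot v v) Num.sqrt);
  last exact: sqrt_continuous.
have FF : Filter (nbhs u) by exact: nbhs_filter.
apply: (cvg_big _ FF) => [|i _]; first exact: add_continuous.
by apply: cvgM; exact: coord_continuous_rV.
Qed.

End euclidean.

(** * Norms on a finite-dimensional space and their duals *)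

Section dual_norm.
Context {R : realType} {d : nat} (N : 'rV[R]_d -> R).
Hypothesis normN : is_norm N.
Implicit Types u v xi : 'rV[R]_d.

Lemma is_norm0 : N 0 = 0.
Proof. by rewrite -(scale0r 0) (is_normZ normN) normr0 mul0r. Qed.

Lemma is_norm_sum_le (I : Type) (r : seq I) (F : I -> 'rV[R]_d) :
  N (\sum_(i <- r) F i) <= \sum_(i <- r) N (F i).
Proof.
elim: r => [|i r IH]; first by rewrite !big_nil is_norm0.
by rewrite !big_cons (le_trans (is_normD normN _ _))// lerD2l.
Qed.

Lemma is_norm_le_mx_norm u : N u <= (\sum_i N (delta_mx 0 i)) * `|u|.
Proof.
rewrite {1}(row_sum_delta u) (le_trans (is_norm_sum_le _ _))// mulr_suml.
apply: ler_sum => i _; rewrite (is_normZ normN) mulrC.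
rewrite ler_wpM2l ?(is_norm_ge0 normN)//.
exact: coord_le_mx_norm.
Qed.

Lemma is_norm_continuous : continuous N.
Proof.
move=> u; apply/(@cvgrPdist_le R R^o _ _ (nbhs_filter u)) => e e0.
pose C := 1 + \sum_i N (delta_mx 0 i).
have C0 : 0 < C.
  by rewrite ltr_pwDl// sumr_ge0// => i _; exact: is_norm_ge0.
near=> v.
have lip a b : N a - N b <= C * `|a - b|.
  rewrite lerBlDr -{1}(subrK b a) (le_trans (is_normD normN _ _))// lerD2r.
  by rewrite (le_trans (is_norm_le_mx_norm _))// ler_wpM2r// lerDr.
have : C * `|u - v| <= e.
  rewrite -ler_pdivlMl// mulrC; near: v.
  by apply: cvgr_dist_le => //; rewrite divr_gt0.
apply: le_trans; rewrite ler_norml lip andbT lerNl opprB distrC; exact: lip.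
Unshelve. all: by end_near. Qed.

(** N is continuous, so it attains a minimum on the unit sphere of the sup
    norm, which is compact; that minimum is positive because N is definite. *)
Lemma is_norm_ge_mx_norm : exists2 c : R, 0 < c & forall u, c * `|u| <= N u.
Proof.
pose S : set 'rV[R]_d := [set u | `|u| = 1].
have [S0|/set0P S0] := eqVneq S set0.
  (* The sphere is empty exactly when the space is trivial. *)
  exists 1 => // u; have [->|u0] := eqVneq u 0.
    by rewrite normr0 mulr0 is_norm0.
  have : S (`|u|^-1 *: u).
    by rewrite /S/= normrZ normfV normr_id mulVf// normr_eq0.
  by rewrite S0.
have cS : compact S.
  apply: bounded_closed_compact.
    by exists 1; split => // x x1 u /= ->; exact: ltW.
  apply: (proj1 (continuous_closedP (fun u : 'rV[R]_d => `|u|)) _ _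
    (@closed_eq R 1)); exact: norm_continuous.
have [c cS' cmin] := EVT_min_rV S0 cS (continuous_subspaceT is_norm_continuous).
move: cS'; rewrite inE => c1.
exists (N c).
  rewrite lt_def (is_norm_ge0 normN) andbT.
  apply/eqP => /(is_norm_eq0 normN) c0.
  by move: c1; rewrite /S /= c0 normr0 => /eqP; rewrite eq_sym oner_eq0.
move=> u; have [->|u0] := eqVneq u 0; first by rewrite normr0 mulr0 is_norm0.
have nu : 0 < `|u| by rewrite normr_gt0.
rewrite -ler_pdivlMr// mulrC.
have := cmin (`|u|^-1 *: u).
rewrite (is_normZ normN) normfV normr_id; apply.
by rewrite inE /S/= normrZ normfV normr_id mulVf// gt_eqF.
Qed.

(** Without this the supremum defining the dual norm would take its default
    value 0; boundedness of the unit ball of N is where finite dimension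
    enters. *)
Lemma dual_norm_has_sup xi : has_sup [set dot xi u | u in [set u | N u <= 1]].
Proof.
split; first by exists (dot xi 0), 0 => //=; rewrite is_norm0 ler01.
have [c c0 cN] := is_norm_ge_mx_norm.
exists ((\sum_i `|xi 0 i|) * c^-1) => _ [u /= u1 <-].
rewrite (le_trans (dot_coord_le _ _))// ler_wpM2l ?sumr_ge0//.
by rewrite -[leRHS]mul1r ler_pdivlMr// mulrC (le_trans (cN u)).
Qed.

Lemma dot_le_dual_norm xi u : dot xi u <= N u * dual_norm N xi.
Proof.
have [->|u0] := eqVneq u 0; first by rewrite dot0r is_norm0 mul0r.
have Nu : 0 < N u.
  rewrite lt_def (is_norm_ge0 normN) andbT; apply: contra_neq u0.
  exact: is_norm_eq0.
rewrite -ler_pdivrMl// -dotZr; apply: ub_le_sup.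
  by have [] := dual_norm_has_sup xi.
exists ((N u)^-1 *: u) => //=.
by rewrite (is_normZ normN) gtr0_norm ?invr_gt0// mulVf// gt_eqF.
Qed.

Lemma dual_norm0 : dual_norm N 0 = 0.
Proof.
rewrite /dual_norm (_ : [set _ | _ in _] = [set 0]) ?sup1//.
apply/seteqP; split => [_ [u _ <-]|_ ->]/=; first by rewrite dot0l.
by exists 0; rewrite ?dot0l//= is_norm0 ler01.
Qed.

End dual_norm.

(** * Smooth and convex functions *)

Section smooth_convex.
Context {R : realType} {d : nat} (f : 'rV[R]_d -> R).
Implicit Types u v h : 'rV[R]_d.

Lemma diff_gradient u h : differentiable f u -> 'd f u h = dot (gradient f u) h.
Proof.
move=> df; rewrite {1}(row_sum_delta h) linear_sum /dot; apply: eq_bigr => i _.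
by rewrite linearZ /= mxE mulrC.
Qed.

(** The difference quotients of f along the line are literally those of the
    directional derivative of f at u + t *: h. *)
Lemma is_derive_line u h (t : R) : differentiable f (u + t *: h) ->
  is_derive t 1 (fun r => f (u + r *: h)) (dot (gradient f (u + t *: h)) h).
Proof.
move=> df; have qE : (fun e : R => e^-1 *:
      (((fun r => f (u + r *: h)) \o shift t) (e *: 1) - f (u + t *: h))) =
    (fun e : R => e^-1 *:
      ((f \o shift (u + t *: h)) (e *: h) - f (u + t *: h))).
  apply/funext => e /=; rewrite scaler1 scalerDl.
  by congr (_ *: (f _ - _)); rewrite addrCA addrA.
split; first by rewrite /derivable qE; exact: diff_derivable.
by rewrite -(diff_gradient _ df) -deriveE// /derive qE.
Qed.

Lemma convex_line u v (t : R) : 0 <= t -> t <= 1 ->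
  convex_function [set: convex_lmodType 'rV[R]_d] f ->
  f (u + t *: (v - u)) <= f u + t * (f v - f u).
Proof.
move=> t0 t1 cf; have := cf (Itv01 t0 t1) v u.
rewrite !inE => /(_ I I); rewrite /conv/= /conv/=.
rewrite (_ : _ *: _ + _ = u + t *: (v - u)).
  move/le_trans; apply; rewrite /unstable.onem.
  by rewrite -[t *: _]/(t * _) -[(1 - t) *: _]/((1 - t) * _); lra.
by rewrite /unstable.onem scalerBl scale1r scalerBr addrCA.
Qed.

(** By convexity every forward difference quotient of f from u towards v is at
    most f v - f u; their limit is the derivative at u. *)
Lemma convex_gradient_le u v :
  (forall w, differentiable f w) ->
  convex_function [set: convex_lmodType 'rV[R]_d] f ->
  f u - f v <= dot (gradient f u) (u - v).
Proof.
move=> df cf; pose h := v - u.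
rewrite -(opprB v u) -/h dotNr lerNr opprB.
have := @is_derive_line u h 0; rewrite scale0r addr0 => /(_ (df u)) [dr dE].
have {dr} : (fun e : R => e^-1 *: (f (u + e *: h) - f u)) @ 0^' -->
    dot (gradient f u) h.
  rewrite -dE; move: dr; rewrite /derivable /derive.
  rewrite (_ : (fun e : R => _ ) =
    (fun e : R => e^-1 *: (f (u + e *: h) - f u)))//.
  by apply/funext => e /=; rewrite scaler1 addr0 scale0r addr0.
move=> /cvg_dnbhs_at_right qcvg; apply: (cvgr_to_le qcvg).
near=> e; have e0 : 0 < e by [].
rewrite /= ler_pdivrMl// lerBlDl; apply: convex_line => //; exact: ltW.
Unshelve. all: by end_near. Qed.

Let descent_arith (L x y a b c n : R) :
  x - b - L / 2 * n - y = (a - b - c * (L * n)) ->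
  a - b <= c * (L * n) -> x <= y + b + L / 2 * n.
Proof. by move=> *; lra. Qed.

(** psi below is f along the segment minus the linear and quadratic terms of
    the bound. At time c its derivative is
    dot (gradient f (u + c h) - gradient f u) h - c L |h|^2, which is
    nonpositive by Cauchy-Schwarz and the Lipschitz bound. *)
Lemma smooth_descent (L : R) u h : smooth L f ->
  f (u + h) <= f u + dot (gradient f u) h + L / 2 * norm2 h ^+ 2.
Proof.
move=> [df lipf].
pose psi (t : R) := f (u + t *: h) - t * dot (gradient f u) h
   - t ^+ 2 * (L / 2 * norm2 h ^+ 2).
pose dpsi (t : R) := dot (gradient f (u + t *: h)) h - dot (gradient f u) h
   - t * (L * norm2 h ^+ 2).
have psiD (t : R) : is_derive t 1 psi (dpsi t).
  have := is_derive_line (df (u + t *: h)) => D.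
  rewrite /psi; apply: is_derive_eq.
  rewrite /dpsi !scaler0 !add0r /GRing.scale /= !mulr1.
  by congr (_ - _); rewrite -mulr2n -[in LHS]mulr_natl; lra.
have psi_cont : {within `[0, 1], continuous psi}.
  by apply: derivable_within_continuous => t _; exact: ex_derive.
have [c] := MVT (@ltr01 R) (fun t _ => psiD t) psi_cont.
rewrite in_itv /= => /andP[c0 c1].
rewrite /psi /dpsi !scale0r !scale1r addr0 !mul1r expr1n mul0r expr0n /=.
rewrite mul0r !subr0 mulr1 mul1r => E.
have slope : dot (gradient f (u + c *: h)) h - dot (gradient f u) h
    <= c * (L * norm2 h ^+ 2).
  rewrite -dotBl (le_trans (cauchy_schwarz _ _))//.
  have := lipf (u + c *: h) u; rewrite (addrC u) addrK norm2Z (gtr0_norm c0).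
  move=> /(ler_wpM2r (norm2_ge0 h)) /le_trans; apply.
  by rewrite le_eqVlt; apply/orP; left; apply/eqP; ring.
exact: descent_arith E slope.
Qed.

(** In dimension 0 smoothness says nothing about the sign of L, so positivity
    is only available for L multiplied by a norm. *)
Lemma smooth_mul_norm2_ge0 (L : R) u : smooth L f -> 0 <= L * norm2 u.
Proof.
by move=> [_ /(_ u 0)]; rewrite subr0; apply: le_trans; exact: norm2_ge0.
Qed.

Lemma smooth_continuous_gradient (L : R) (i : 'I_d) : smooth L f ->
  continuous (fun u => gradient f u 0 i).
Proof.
move=> [_ lipf] u; apply/(@cvgrPdist_le R R^o _ _ (nbhs_filter u)) => e e0.
have c : (fun v => L * norm2 (u - v)) @ u --> L * norm2 (u - u).
  have FF : Filter (nbhs u) by exact: nbhs_filter.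
  apply: cvgMl_tmp.
  apply: (cvg_comp (fun v => u - v) norm2 (G := nbhs (u - u))).
    by apply: (cvgB (FF := FF)); [exact: cvg_cst|exact: cvg_id].
  exact: continuous_norm2.
move: c; rewrite subrr -(scale0r 0) norm2Z normr0 mul0r mulr0.
move=> /(@cvgr0_norm_le _ R^o) /(_ _ e0) c; near=> v.
rewrite -rowB (le_trans (coord_le_norm2 _ i))//.
by rewrite (le_trans (lipf _ _))// (le_trans (ler_norm _))//; near: v.
Unshelve. all: by end_near. Qed.

End smooth_convex.

(** * Borel measurability and independent pairs *)

Section probability.
Context {R : realType}.

Lemma borel_rV_measurable_fun {d : nat} (g : 'rV[R]_d -> R) :
  continuous g -> measurable_fun [set: borel_rV R d] (g : borel_rV R d -> R).
Proof.
move=> /continuousP cg; apply: (measurability _ (RGenOpens.measurableE R)).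
move=> _ [_ [a [b ->] <-]]; rewrite setTI.
by apply: sub_sigma_algebra; apply/cg/interval_open.
Qed.

Lemma measurable_abs_dot_gradient {d : nat} (f : 'rV[R]_d -> R) (L : R) :
  smooth L f ->
  measurable_fun [set: borel_rV R d * borel_rV R d]
    (fun p => `|dot (gradient f p.1) p.2|).
Proof.
move=> sf; apply: measurableT_comp => //; apply: measurable_sum => i.
apply: measurable_funM.
  have m := borel_rV_measurable_fun (smooth_continuous_gradient (i := i) sf).
  exact: (measurableT_comp m measurable_fst).
have m := borel_rV_measurable_fun (@coord_continuous_rV R d i).
exact: (measurableT_comp m measurable_snd).
Qed.

(** Independence identifies the law of (X, Y) with the product of the laws,
    after which Tonelli's theorem applies. *)
Lemma integral_independent_pair {dT d1 d2 : measure_display}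
    {T : measurableType dT} {T1 : measurableType d1} {T2 : measurableType d2}
    (P : probability T R) (X : {RV P >-> T1}) (Y : {RV P >-> T2})
    (h : T1 * T2 -> \bar R) :
  (forall A B, measurable A -> measurable B ->
    P (X @^-1` A `&` Y @^-1` B) = P (X @^-1` A) * P (Y @^-1` B))%E ->
  measurable_fun setT h -> (forall p, 0 <= h p)%E ->
  (\int[P]_w h (X w, Y w) = \int[P]_w \int[distribution P Y]_y h (X w, y))%E.
Proof.
move=> indep mh h0.
have mXY : measurable_fun setT (fun w => (X w, Y w)).
  exact: measurable_fun_pair.
pose XY : {RV P >-> (T1 * T2)%type} := HB.pack (fun w => (X w, Y w))
  (isMeasurableFun.Build _ _ _ _ _ mXY).
rewrite -(ge0_integral_distribution XY mh h0).
have -> : (\int[distribution P XY]_p h p =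
    \int[distribution P X \x distribution P Y]_p h p)%E.
  by apply: eq_measure_integral => A mA _; apply/esym/product_measure_unique.
rewrite fubini_tonelli1//; apply: ge0_integral_distribution.
  exact: measurable_fun_fubini_tonelli_F.
by move=> x; apply: integral_ge0.
Qed.

Lemma integral_same_law {dT d1 : measure_display} {T : measurableType dT}
    {T1 : measurableType d1} (P : probability T R) (X : {RV P >-> T1})
    (D : probability T1 R) (h : T1 -> \bar R) :
  (forall B, measurable B -> distribution P X B = D B) ->
  (\int[distribution P X]_y h y = \int[D]_y h y)%E.
Proof. by move=> XD; apply: eq_measure_integral => A mA _; exact: XD. Qed.

(** A lower bound on the integral over Y, valid for every fixed value of X,
    survives the integration over X. This plays the role of a conditional
    expectation given X. *)
Lemma integral_independent_pair_ge {dT d1 d2 : measure_display}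
    {T : measurableType dT} {T1 : measurableType d1} {T2 : measurableType d2}
    (P : probability T R) (X : {RV P >-> T1}) (Y : {RV P >-> T2})
    (D : probability T2 R) (g : T -> \bar R) (h : T1 * T2 -> \bar R) :
  (forall A B, measurable A -> measurable B ->
    P (X @^-1` A `&` Y @^-1` B) = P (X @^-1` A) * P (Y @^-1` B))%E ->
  (forall B, measurable B -> distribution P Y B = D B) ->
  measurable_fun setT h -> (forall p, 0 <= h p)%E ->
  measurable_fun setT g -> (forall w, 0 <= g w)%E ->
  (forall w, g w <= \int[D]_y h (X w, y))%E ->
  (\int[P]_w g w <= \int[P]_w h (X w, Y w))%E.
Proof.
move=> indep YD mh h0 mg g0 gh; rewrite integral_independent_pair//.
apply: ge0_le_integral => //.
  apply: (measurableT_comp (f := fubini_F (distribution P Y) h)) => //.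
  exact: measurable_fun_fubini_tonelli_F.
by move=> w _; rewrite (integral_same_law _ YD).
Qed.

End probability.

(** * The iterates of the algorithm *)

Section smtp_iterates.
Context {dT : measure_display} {T : measurableType dT} {R : realType} {d : nat}.
Variables (P : probability T R) (f : 'rV[R]_d -> R).
Variables (D : probability (borel_rV R d) R) (gamma beta : R) (x0 : 'rV[R]_d).
Variables s x v z : nat -> {RV P >-> borel_rV R d}.
Hypothesis beta1 : beta < 1.
Hypothesis smtp : SMTP f D (fun=> gamma) beta x0 s x v z.

Let delta := gamma / (1 - beta).

(** Total displacement gamma + gamma beta / (1 - beta) = delta along
    beta m + a; since delta beta = gamma beta / (1 - beta), the part along m is
    the correction already contained in z. *)
Lemma virtual_step (y m a : 'rV[R]_d) :
  y - gamma *: (beta *: m + a) - (gamma * beta / (1 - beta)) *: (beta *: m + a) =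
  y - (gamma * beta / (1 - beta)) *: m - delta *: a.
Proof.
have b0 : 1 - beta != 0 by rewrite subr_eq0 gt_eqF.
apply/rowP => i; rewrite !mxE /delta; field.
exact: b0.
Qed.

Lemma smtp_virtual_iterate k w :
  z k w = (x k w : 'rV[R]_d) - (gamma * beta / (1 - beta)) *: (v k w : 'rV[R]_d)
  :> 'rV[R]_d.
Proof.
elim: k => [|k IH].
  by have [-> -> ->] := smtp_init smtp w; rewrite scaler0 subr0.
have [_] := smtp_iter smtp k w.
by case=> [[-> -> ->]|[-> -> ->]|[-> -> ->]].
Qed.

Lemma smtp_decrease k w :
  [/\ f (z k.+1 w) <= f (z k w),
      f (z k.+1 w) <= f ((z k w : 'rV[R]_d) - delta *: (s k w : 'rV[R]_d)) &
      f (z k.+1 w) <= f ((z k w : 'rV[R]_d) + delta *: (s k w : 'rV[R]_d))].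
Proof.
have [[h0 hp hm] _] := smtp_iter smtp k w.
rewrite virtual_step -smtp_virtual_iterate in hp.
rewrite virtual_step -smtp_virtual_iterate scalerN opprK in hm.
by split.
Qed.

Lemma smtp_le_init k w : f (z k w) <= f x0.
Proof.
elim: k => [|k IH]; first by have [_ _ ->] := smtp_init smtp w.
by have [h _ _] := smtp_decrease k w; exact: le_trans IH.
Qed.

(** Whichever sign makes the linear term of the descent inequality negative is
    among the two trial points. *)
Lemma smtp_descent (L : R) k w : smooth L f ->
  f (z k.+1 w) + delta * `|dot (gradient f (z k w)) (s k w)| <=
  f (z k w) + L / 2 * delta ^+ 2 * norm2 (s k w) ^+ 2.
Proof.
move=> sf; have [_] := smtp_decrease k w.
move: (z k w : 'rV[R]_d) (s k w : 'rV[R]_d) (f (z k.+1 w)) => y a t.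
have := smooth_descent y (- (delta *: a)) sf.
have := smooth_descent y (delta *: a) sf.
rewrite dotNr -scaleN1r !norm2Z normrN1 mul1r dotZr exprMn real_normK ?num_real//.
move: (dot _ _) => b; rewrite scaleN1r.
move: (f (y - _)) (f (y + _)) (f y) (norm2 a ^+ 2) => fm fp fy n ? ? ? ?.
case: (ger0P b) => _; lra.
Qed.

(** The history before sampling s k contains the sigma-algebra of z k. *)
Lemma smtp_independent k (A B : set (borel_rV R d)) :
  measurable A -> measurable B ->
  (P (z k @^-1` A `&` s k @^-1` B) = P (z k @^-1` A) * P (s k @^-1` B))%E.
Proof.
move=> mA mB; apply: (smtp_indep smtp) => //.
apply: sub_sigma_algebra; left; exists k; first exact: leqnn.
by right; exists A; rewrite ?setTI.
Qed.

End smtp_iterates.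

(** * Real recursions and rounding *)

(** c / q is the fixed point of the recursion, and the distance to it
    contracts by the factor 1 - q. *)
Lemma affine_recursion_le (R : realType) (a : nat -> R) (q c : R) :
  0 < q -> q <= 1 -> (forall k, a k.+1 <= (1 - q) * a k + c) ->
  forall k, 0 <= c -> a k <= (1 - q) ^+ k * a 0%N + c / q.
Proof.
move=> q0 q1 rec k c0; elim: k => [|k IH].
  by rewrite expr0 mul1r lerDl divr_ge0// ltW.
apply: (le_trans (rec k)).
have q1' : 0 <= 1 - q by rewrite subr_ge0.
apply: (le_trans (lerD (ler_wpM2l q1' IH) (lexx c))).
rewrite le_eqVlt; apply/orP; left; apply/eqP; rewrite exprS; field.
by rewrite gt_eqF.
Qed.

Lemma expr_onem_le_expR (R : realType) (q : R) n :
  q <= 1 -> (1 - q) ^+ n <= expR (- (q * n%:R)).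
Proof.
move=> q1; rewrite -mulNr expRM_natr.
by apply: lerXn2r; rewrite ?nnegrE ?subr_ge0 ?expR_ge0 ?expR_ge1Dx.
Qed.

Lemma nat_ceil_ge (R : realType) (a : R) : a <= (nat_ceil a)%:R.
Proof.
rewrite /nat_ceil natr_absz ger0_norm; last first.
  by rewrite ceil_ge0 lt_max ltrN10.
by rewrite (le_trans _ (ceil_ge _))// le_max lexx orbT.
Qed.

(** (1 - q)^n <= exp (- q n), and n >= ln (2 G / eps) / q. The case G = 0 is
    apart because ln 0 carries no information. *)
Lemma nat_ceil_decay_le (R : realType) (q G eps : R) :
  0 < q -> q <= 1 -> 0 < eps -> 0 <= G ->
  (1 - q) ^+ nat_ceil (q^-1 * ln (2 * G / eps)) * G <= eps / 2.
Proof.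
move=> q0 q1 eps0; rewrite le_eqVlt => /predU1P[<-|G0].
  by rewrite mulr0 divr_ge0// ltW.
set n := nat_ceil _.
rewrite -ler_pdivlMr//; apply: (le_trans (expr_onem_le_expR _ q1)).
have pos : 0 < 2 * G / eps by rewrite divr_gt0// mulr_gt0.
have -> : eps / 2 / G = expR (- ln (2 * G / eps)).
  by rewrite expRN lnK ?posrE//; field; rewrite !gt_eqF.
by rewrite ler_expR lerN2 -ler_pdivrMl// nat_ceil_ge.
Qed.

(** * Decrease of the expected optimality gap *)

Section expected_decrease.
Context {dT : measure_display} {T : measurableType dT} {R : realType} {d : nat}.
Variables (P : probability T R) (f : 'rV[R]_d -> R) (L : R) (x0 xs : 'rV[R]_d).
Variables (D : probability (borel_rV R d) R) (mu : R) (N : 'rV[R]_d -> R).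
Variables (gamma beta : R).
Variables s x v z : nat -> {RV P >-> borel_rV R d}.
Hypothesis sf : smooth L f.
Hypothesis cf : convex_function [set: convex_lmodType 'rV[R]_d] f.
Hypothesis fmin : forall y, f xs <= f y.
Hypothesis aD : assumption_D D mu N.
Hypothesis level_bounded : has_ubound (level_dists f N x0 xs).
Hypothesis beta1 : beta < 1.
Hypothesis smtp : SMTP f D (fun=> gamma) beta x0 s x v z.

Let R0 := sup (level_dists f N x0 xs).
Let gammaD := fine (second_moment D).
Let delta := gamma / (1 - beta).
Let gap k w := f (z k w) - f xs.
Let slope k w := `|dot (gradient f (z k w)) (s k w)|.

(** xs lies in the level set, at distance 0 from itself. *)
Lemma level_radius_ge0 : 0 <= R0.
Proof.
have [_ _ normN _] := aD; rewrite -(dual_norm0 normN); apply: ub_le_sup => //.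
by exists xs; rewrite ?subrr//=; exact: fmin.
Qed.

(** f y - f xs <= <grad f y, y - xs> <= N (grad f y) times the dual norm of
    y - xs, and the latter is at most the radius of the level set. *)
Lemma gap_le_gradient (y : 'rV[R]_d) :
  f y <= f x0 -> f y - f xs <= R0 * N (gradient f y).
Proof.
have [_ _ normN _] := aD => yx0.
apply: (le_trans (convex_gradient_le y xs sf.1 cf)).
rewrite dotC (le_trans (dot_le_dual_norm normN _ _))// mulrC ler_wpM2r//.
  exact: is_norm_ge0.
by apply: ub_le_sup => //; exists y.
Qed.

Lemma gap_ge0 k w : 0 <= gap k w.
Proof. by rewrite subr_ge0. Qed.

Lemma measurable_f_iterate k : measurable_fun setT (fun w => f (z k w)).
Proof.
have m : measurable_fun [set: borel_rV R d] (f : borel_rV R d -> R).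
  apply: borel_rV_measurable_fun => u.
  by apply: differentiable_continuous; exact: sf.1.
exact: (measurableT_comp m).
Qed.

Lemma measurable_gap k : measurable_fun setT (gap k).
Proof. by apply: measurable_funB => //; exact: measurable_f_iterate. Qed.

Lemma measurable_slope k : measurable_fun setT (slope k).
Proof.
have m : measurable_fun setT (fun w => (z k w, s k w)).
  exact: measurable_fun_pair.
exact: (measurableT_comp (measurable_abs_dot_gradient sf) m).
Qed.

Lemma integrable_f_iterate k :
  P.-integrable setT (EFin \o (fun w => f (z k w))).
Proof.
have PT : (P setT < +oo)%E by rewrite probability_setT ltry.
apply: (measurable_bounded_integrable measurableT PT (measurable_f_iterate k)).
exists (Num.max `|f xs| `|f x0|); split; first exact: num_real.
move=> M ltM w _ /=; apply/ltW/(le_lt_trans _ ltM).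
have := fmin (z k w); have := smtp_le_init beta1 smtp k w.
move: (f (z k w)) => t tx0 xst; apply/ler_normlP; split; rewrite le_max.
  by rewrite -(normrN (f xs)) (le_trans _ (ler_norm (- f xs))) ?lerN2.
by rewrite (le_trans tx0 (ler_norm _)) orbT.
Qed.

Lemma integrable_gap k : P.-integrable setT (EFin \o gap k).
Proof.
rewrite (_ : EFin \o _ = (EFin \o (fun w => f (z k w))) \- cst (f xs)%:E)%E//.
apply: integrableB => //; first exact: integrable_f_iterate.
exact: finite_measure_integrable_cst.
Qed.

(** For a fixed value of z k the integral over the sample is at least
    mu N (grad f (z k)) by the assumption on D. *)
Lemma expected_slope_ge k :
  (mu%:E * \int[P]_w (gap k w)%:E <= R0%:E * \int[P]_w (slope k w)%:E)%E.
Proof.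
have [_ mu0 normN DN] := aD; have R00 := level_radius_ge0.
have mslope : measurable_fun setT (EFin \o slope k).
  by apply/measurable_EFinP; exact: measurable_slope.
have mgap : measurable_fun setT (EFin \o gap k).
  by apply/measurable_EFinP; exact: measurable_gap.
rewrite -(ge0_integralZl_EFin P measurableT _ mgap) ?(ltW mu0)//; last first.
  by move=> w _; rewrite lee_fin gap_ge0.
rewrite -(ge0_integralZl_EFin P measurableT _ mslope)//; last first.
  by move=> w _; rewrite lee_fin normr_ge0.
pose h (p : borel_rV R d * borel_rV R d) :=
  (R0%:E * (`|dot (gradient f p.1) p.2|)%:E)%E.
have mabs := measurable_abs_dot_gradient sf.
apply: (integral_independent_pair_ge (h := h) (smtp_independent smtp k)
  (smtp_law smtp k)).
- by apply: measurable_funeM; exact/measurable_EFinP.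
- by move=> p; rewrite mule_ge0// lee_fin.
- exact: measurable_funeM.
- by move=> w; rewrite mule_ge0// lee_fin ?gap_ge0// ltW.
move=> w; rewrite /h ge0_integralZl_EFin//; last first.
  apply/measurable_EFinP.
  exact: (measurable_fun_pair2 (z k w : borel_rV R d) mabs).
apply: (@le_trans _ _ (R0%:E * (mu * N (gradient f (z k w)))%:E)%E).
  rewrite -!EFinM lee_fin mulrCA ler_pM2l//.
  by apply: gap_le_gradient; exact: smtp_le_init beta1 smtp k w.
rewrite lee_wpmul2l ?lee_fin//.
by have := DN (gradient f (z k w)); rewrite unlock.
Qed.

Lemma integral_norm2_sample k :
  (\int[P]_w (norm2 (s k w) ^+ 2)%:E)%E = gammaD%:E.
Proof.
have [D2 _ _ _] := aD.
pose n2 (a : borel_rV R d) := (norm2 a ^+ 2)%:E.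
have mn2 : measurable_fun setT n2.
  apply/measurable_EFinP; apply: (measurable_funX 2).
  apply: borel_rV_measurable_fun; exact: continuous_norm2.
have n20 a : (0 <= n2 a)%E by rewrite lee_fin sqr_ge0.
rewrite -(ge0_integral_distribution (s k) mn2 n20).
rewrite (integral_same_law _ (smtp_law smtp k)) /gammaD fineK.
  by rewrite /second_moment unlock.
rewrite ge0_fin_numE//; apply: expectation_ge0 => a; exact: sqr_ge0.
Qed.

Lemma integrable_norm2_sample k :
  P.-integrable setT (EFin \o (fun w => norm2 (s k w) ^+ 2)).
Proof.
apply/integrableP; split.
  apply/measurable_EFinP; apply: (measurable_funX 2).
  have m : measurable_fun [set: borel_rV R d] (@norm2 R d : borel_rV R d -> R).
    by apply: borel_rV_measurable_fun; exact: continuous_norm2.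
  exact: (measurableT_comp m).
under eq_integral do rewrite /= ger0_norm ?sqr_ge0//.
by rewrite integral_norm2_sample ltry.
Qed.

Lemma expected_descent k : 0 <= delta ->
  (\int[P]_w (gap k.+1 w)%:E + delta%:E * \int[P]_w (slope k w)%:E <=
   \int[P]_w (gap k w)%:E + (L / 2 * delta ^+ 2 * gammaD)%:E)%E.
Proof.
move=> delta0.
have c0 w : 0 <= L / 2 * delta ^+ 2 * norm2 (s k w) ^+ 2.
  have := smooth_mul_norm2_ge0 (s k w) sf.
  move=> /(mulr_ge0 (norm2_ge0 (s k w))) /(mulr_ge0 (sqr_ge0 delta)); lra.
have mslope : measurable_fun setT (EFin \o slope k).
  by apply/measurable_EFinP; exact: measurable_slope.
have mgap j : measurable_fun setT (EFin \o gap j).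
  by apply/measurable_EFinP; exact: measurable_gap.
have isample := integrable_norm2_sample k.
rewrite (EFinM _ gammaD) -(integral_norm2_sample k).
rewrite -(integralZl measurableT isample).
rewrite -(ge0_integralZl_EFin P measurableT _ mslope)//; last first.
  by move=> w _; rewrite lee_fin normr_ge0.
have msample : measurable_fun setT (fun w =>
    ((L / 2 * delta ^+ 2)%:E * (EFin \o (fun w => norm2 (s k w) ^+ 2)%R) w)%E).
  by apply: measurable_funeM; exact: measurable_int isample.
have gap0 j w : setT w -> (0 <= (EFin \o gap j) w)%E.
  by move=> _; rewrite lee_fin gap_ge0.
have slope0 w : setT w -> (0 <= delta%:E * (EFin \o slope k) w)%E.
  by move=> _; apply: mule_ge0; rewrite lee_fin ?normr_ge0.
have sample0 w : setT w -> (0 <= (L / 2 * delta ^+ 2)%:E *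
    (EFin \o (fun w => norm2 (s k w) ^+ 2)%R) w)%E.
  by move=> _; rewrite /= -EFinM lee_fin.
rewrite -(ge0_integralD P measurableT (gap0 k.+1) (mgap _) slope0
  (measurable_funeM _ mslope)).
rewrite -(ge0_integralD P measurableT (gap0 k) (mgap _) sample0 msample).
apply: ge0_le_integral => //.
- by move=> w Tw; apply: adde_ge0; [exact: gap0|exact: slope0].
- by apply: emeasurable_funD => //; exact: measurable_funeM.
- exact: emeasurable_funD.
move=> w _; rewrite /= -!EFinM -!EFinD lee_fin /gap addrAC (addrAC (f (z k w))).
by rewrite lerD2r; exact: smtp_descent beta1 smtp _ _ _ sf.
Qed.

Let expected_gap k := fine (\int[P]_w (gap k w)%:E).

Lemma expected_gapE k : (\int[P]_w (gap k w)%:E)%E = (expected_gap k)%:E.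
Proof. by rewrite fineK// integrable_fin_num//; exact: integrable_gap. Qed.

(** Eliminate the expected slope between expected_descent and
    expected_slope_ge; it is finite because the former bounds it. *)
Lemma expected_gap_recursion k : 0 < gamma -> 0 < R0 ->
  expected_gap k.+1 <=
  (1 - gamma * mu / ((1 - beta) * R0)) * expected_gap k
  + L / 2 * delta ^+ 2 * gammaD.
Proof.
move=> gamma0 R00; have delta0 : 0 < delta by rewrite divr_gt0// subr_gt0.
have := expected_slope_ge k; have := expected_descent k (ltW delta0).
rewrite !expected_gapE.
have : (0 <= \int[P]_w (slope k w)%:E)%E.
  by apply: integral_ge0 => w _; rewrite lee_fin normr_ge0.
case: (\int[P]_w (slope k w)%:E)%E => [S| |]//; last first.
  by rewrite gt0_muley ?lte_fin// addey// => _; rewrite -EFinD leye_eq.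
move=> _; rewrite -!EFinM -!EFinD !lee_fin => desc slopege.
have -> : gamma * mu / ((1 - beta) * R0) = delta * (mu / R0).
  by rewrite /delta invfM mulrACA -!mulrA.
have : mu / R0 * expected_gap k <= S.
  by rewrite mulrAC ler_pdivrMr// (mulrC S).
move=> /(ler_wpM2l (ltW delta0)); move: desc.
move: (expected_gap k.+1) (expected_gap k) (mu / R0) => a' a m *; lra.
Qed.

Lemma smooth_mul_second_moment_ge0 : 0 <= L * gammaD.
Proof.
rewrite -lee_fin EFinM -(integral_norm2_sample 0).
rewrite -(integralZl measurableT (integrable_norm2_sample 0)).
apply: integral_ge0 => w _; rewrite /= -EFinM lee_fin expr2 mulrA.
by rewrite mulr_ge0 ?norm2_ge0//; exact: smooth_mul_norm2_ge0 sf.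
Qed.

Lemma expected_gap0 : expected_gap 0 = f x0 - f xs.
Proof.
rewrite /expected_gap -[RHS]/(fine (f x0 - f xs)%:E) -(expectation_cst P) unlock.
congr fine; apply: eq_integral => w _.
by rewrite /gap; have [_ _ ->] := smtp_init smtp w.
Qed.

Lemma expected_gap_le k : 0 < gamma -> 0 < R0 ->
  gamma * mu / ((1 - beta) * R0) <= 1 ->
  expected_gap k <=
  (1 - gamma * mu / ((1 - beta) * R0)) ^+ k * (f x0 - f xs)
  + L * gamma * gammaD * R0 / (2 * (1 - beta) * mu).
Proof.
move=> gamma0 R00 q1; have [_ mu0 _ _] := aD.
have beta0 : 0 < 1 - beta by rewrite subr_gt0.
have q0 : 0 < gamma * mu / ((1 - beta) * R0) by rewrite divr_gt0// mulr_gt0.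
have c0 : 0 <= L / 2 * delta ^+ 2 * gammaD.
  have := mulr_ge0 (sqr_ge0 delta) smooth_mul_second_moment_ge0; lra.
have rec j := expected_gap_recursion j gamma0 R00.
apply: (le_trans (affine_recursion_le q0 q1 rec k c0)).
rewrite expected_gap0 lerD2l le_eqVlt; apply/orP; left; apply/eqP.
by rewrite /delta; field; rewrite !gt_eqF.
Qed.

End expected_decrease.

(** * Convergence rate and complexity *)

Theorem theorem3p2 (R : realType) (d : nat) (f : 'rV[R]_d -> R) (L : R)
    (x0 xs : 'rV[R]_d) (D : probability (borel_rV R d) R) (mu : R)
    (N : 'rV[R]_d -> R) (beta : R) :
  let gammaD := fine (second_moment D) in
  let R0 := sup (level_dists f N x0 xs) in
  smooth L f ->
  convex_function [set: convex_lmodType 'rV[R]_d] f ->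
  (forall x, f xs <= f x) ->
  assumption_D D mu N ->
  has_ubound (level_dists f N x0 xs) ->
  0 <= beta < 1 ->
  (forall gamma : R, 0 < gamma -> gamma < (1 - beta) * R0 / mu ->
   forall (dT : measure_display) (T : measurableType dT) (P : probability T R)
     (s x v z : nat -> {RV P >-> borel_rV R d}),
   SMTP f D (fun=> gamma) beta x0 s x v z ->
   forall k : nat,
   ('E_P[fun w => (f (z k w) - f xs)%R] <=
     ((1 - gamma * mu / ((1 - beta) * R0)) ^+ k * (f x0 - f xs)
      + L * gamma * gammaD * R0 / (2 * (1 - beta) * mu))%:E)%E) /\
  (forall eps : R, 0 < eps -> eps <= L * gammaD * R0 ^+ 2 / mu ^+ 2 ->
   let gamma := eps * (1 - beta) * mu / (L * gammaD * R0) in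
   let K := nat_ceil (eps^-1 * (L * gammaD * R0 ^+ 2 / mu ^+ 2)
                      * ln (2 * (f x0 - f xs) / eps)) in
   forall (dT : measure_display) (T : measurableType dT) (P : probability T R)
     (s x v z : nat -> {RV P >-> borel_rV R d}),
   SMTP f D (fun=> gamma) beta x0 s x v z ->
   ('E_P[fun w => f (z K w)] - (f xs)%:E <= eps%:E)%E).
Proof.
move=> gammaD R0 sf cf fmin aD ub /andP[_ beta1].
have b0 : 0 < 1 - beta by rewrite subr_gt0.
have [_ mu0 _ _] := aD.
have R0_ge0 := level_radius_ge0 fmin aD ub.
split.
  move=> gamma gamma0 gammalt dT T P s x v z smtp k.
  have R0_gt0 : 0 < R0.
    move: (lt_trans gamma0 gammalt).
    by rewrite pmulr_lgt0 ?invr_gt0// pmulr_rgt0.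
  rewrite unlock (expected_gapE sf fmin beta1 smtp) lee_fin.
  apply: (expected_gap_le sf cf fmin aD ub beta1 smtp) => //.
  by rewrite ler_pdivrMr ?mulr_gt0// mul1r -ler_pdivlMr// ltW.
move=> eps eps0 epsle gamma K dT T P s x v z smtp.
(* eps > 0 forces its upper bound, hence L, gammaD and R0, to be nonzero. *)
have M0 : 0 < L * gammaD * R0 ^+ 2.
  move: (lt_le_trans eps0 epsle).
  by rewrite pmulr_lgt0// invr_gt0 exprn_gt0.
have R0_gt0 : 0 < R0.
  rewrite lt_def R0_ge0 andbT; apply: contraTneq M0 => ->.
  by rewrite expr0n /= mulr0 ltxx.
have LG0 : 0 < L * gammaD by move: M0; rewrite pmulr_lgt0// exprn_gt0.
have gamma0 : 0 < gamma.
  apply: divr_gt0; last exact: mulr_gt0.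
  by apply: mulr_gt0 => //; exact: mulr_gt0.
have [LN0 gN0] : L != 0 /\ gammaD != 0.
  by apply/andP; rewrite -negb_or -mulf_eq0 gt_eqF.
have [R0N0 muN0 bN0 epsN0] : [/\ R0 != 0, mu != 0, 1 - beta != 0 & eps != 0].
  by rewrite !gt_eqF.
pose q := gamma * mu / ((1 - beta) * R0).
have qE : q^-1 = eps^-1 * (L * gammaD * R0 ^+ 2 / mu ^+ 2).
  rewrite /q /gamma; field.
  by rewrite R0N0 muN0 bN0 epsN0 LN0 gN0.
have q0 : 0 < q by rewrite divr_gt0// mulr_gt0.
have q1 : q <= 1.
  rewrite -(invrK q) invf_le1 ?invr_gt0// qE -ler_pdivrMl ?invr_gt0//.
  by rewrite invrK mulr1.
have intf := integrable_f_iterate sf fmin beta1 smtp K.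
have icst := finite_measure_integrable_cst P (f xs) measurableT.
have -> : ('E_P[fun w => f (z K w)] - (f xs)%:E =
    \int[P]_w (f (z K w) - f xs)%:E)%E.
  rewrite (integralB_EFin measurableT intf icst).
  have := expectation_cst P (f xs); rewrite expectation.unlock => Ecst.
  by rewrite [X in (_ = _ - X)%E]Ecst.
rewrite (expected_gapE sf fmin beta1 smtp) lee_fin.
apply: (le_trans (expected_gap_le sf cf fmin aD ub beta1 smtp K gamma0 R0_gt0
  q1)).
have -> : L * gamma * gammaD * R0 / (2 * (1 - beta) * mu) = eps / 2.
  rewrite /gamma; field.
  by rewrite R0N0 muN0 bN0 LN0 gN0.
rewrite [leRHS]splitr lerD2r -/q /K -qE.
by apply: nat_ceil_decay_le => //; rewrite subr_ge0.
Qed.
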